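(* Let $R$ be a commutative differential ring with ring of constants $R^D$. The functor $P_0\mapsto R\otimes_{R^D}P_0$ from finitely generated projective $R^D$-modules to differential finitely generated projective $R$-modules induces a group isomorphism $q: PC(R^D)\to U(PC^{\text{diff}}(R))$.
   Context: $R$ is a commutative differential ring with derivation $D=D_R$; $R^D=\{r\in R: D(r)=0\}$ is its ring of constants. A differential projective module over $R$ is a finitely generated projective $R$-module $M$ with an additive endomorphism $D_M$ such that $D_M(rm)=D_R(r)m+rD_M(m)$. Differential homomorphisms are $R$-linear maps commuting with the derivations. Direct sums carry the componentwise derivation. $(R^n,0)$ denotes $R^n$ with the componentwise derivation. For an $R^D$-module $P_0$, $R\otimes_{R^D}P_0$ has derivation $D_R\otimes \mathrm{id}$. All monoids are commutative and written additively. If $N$ is a submonoid of a monoid $M$, then $M/N$ is the monoid of equivalence classes of $M$ under $m_1\sim m_2$ iff there are $n_1,n_2\in N$ with $m_1+n_1=m_2+n_2$. $U(M)$ denotes the group of invertible elements of $M$. For a commutative ring $S$, $P(S)$ is the monoid (under direct sum) of isomorphism classes of finitely generated projective $S$-modules, $F(S)$ is its submonoid of classes of free modules of finite rank, and $PC(S)=P(S)/F(S)$ (which is a group). $P^{\text{diff}}(R)$ is the monoid (under direct sum) of differential isomorphism classes of differential finitely generated projective $R$-modules, $F_0^{\text{diff}}(R)$ is the submonoid of classes of modules of the form $(R^n,0)$, and $PC^{\text{diff}}(R)=P^{\text{diff}}(R)/F_0^{\text{diff}}(R)$. *)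

(* Defs.v *)
From HB Require Import structures.
From mathcomp Require Import all_boot all_algebra boolp.

Set Implicit Arguments.
Unset Strict Implicit.
Unset Printing Implicit Defensive.

Import GRing.Theory.

Local Open Scope ring_scope.
Local Open Scope quotient_scope.

(* The monoids of isomorphism classes below are quotients of the large type of
   all modules over a ring; they do not fit in the universe of nmodType, which
   lies strictly below that of lmodType R. Hence dedicated structures. *)

Record comMonoid := ComMonoid {
  mcarrier :> Type;
  mzero : mcarrier;
  madd : mcarrier -> mcarrier -> mcarrier;
  maddA : forall x y z, madd x (madd y z) = madd (madd x y) z;
  maddC : forall x y, madd x y = madd y x;
  madd0 : forall x, madd mzero x = x
}.

Declare Scope cmon_scope.
Delimit Scope cmon_scope with M.
Notation "x + y" := (madd x y) : cmon_scope.
Notation "0" := (mzero _) : cmon_scope.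

Record abGroup := AbGroup {
  gmonoid :> comMonoid;
  gopp : gmonoid -> gmonoid;
  gaddN : forall x : gmonoid, (x + gopp x = 0)%M
}.

Definition group_isomorphism (G H : abGroup) (q : G -> H) : Prop :=
  (forall x y : G, q (x + y)%M = (q x + q y)%M) /\ bijective q.

Record submonoid (M : comMonoid) := Submonoid {
  in_submonoid :> M -> Prop;
  submonoid0 : in_submonoid 0%M;
  submonoidD : forall x y, in_submonoid x -> in_submonoid y ->
    in_submonoid (x + y)%M
}.

Section Quotient.
Variables (T : Type) (e : T -> T -> Prop).

Record equivalence_prop : Prop := EquivalenceProp {
  equiv_refl : forall x, e x x;
  equiv_sym : forall x y, e x y -> e y x;
  equiv_trans : forall x y z, e x y -> e y z -> e x z
}.

Definition quot := {C : T -> Prop | exists x, C = e x}.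

Definition cls (x : T) : quot := exist _ (e x) (ex_intro _ x erefl).

Definition quot_repr (c : quot) : T := sval (cid (svalP c)).

Lemma eq_quot (c d : quot) : sval c = sval d -> c = d.
Proof.
case: c d => [C hC] [D hD] /= E; rewrite E in hC *.
by rewrite (Prop_irrelevance hC hD).
Qed.

Lemma quot_reprK c : cls (quot_repr c) = c.
Proof.
case: c => C hC; apply: eq_quot; rewrite /= /quot_repr /=.
by case: cid.
Qed.

Lemma quotP c : exists x, c = cls x.
Proof. by exists (quot_repr c); rewrite quot_reprK. Qed.

Hypothesis eP : equivalence_prop.

Lemma clsP x y : cls x = cls y <-> e x y.
Proof.
split=> [[->]|exy]; first exact: (equiv_refl eP).
apply: eq_quot; apply: funext => z; apply: propext; split.
- exact: (equiv_trans eP (equiv_sym eP exy)).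
- exact: (equiv_trans eP exy).
Qed.

Lemma repr_cls x : e (quot_repr (cls x)) x.
Proof. by apply/clsP; rewrite quot_reprK. Qed.

Variables (z : T) (op : T -> T -> T).
Hypothesis op_congr : forall x x' y y', e x x' -> e y y' ->
  e (op x y) (op x' y').
Hypothesis opA : forall x y t, e (op x (op y t)) (op (op x y) t).
Hypothesis opC : forall x y, e (op x y) (op y x).
Hypothesis op0 : forall x, e (op z x) x.

Definition quot_add (a b : quot) : quot := cls (op (quot_repr a) (quot_repr b)).

Lemma quot_add_cls x y : quot_add (cls x) (cls y) = cls (op x y).
Proof. by apply/clsP; apply: op_congr; apply: repr_cls. Qed.

Fact quot_addA a b c : quot_add a (quot_add b c) = quot_add (quot_add a b) c.
Proof.
have [x ->] := quotP a; have [y ->] := quotP b; have [t ->] := quotP c.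
by rewrite !quot_add_cls; apply/clsP.
Qed.

Fact quot_addC a b : quot_add a b = quot_add b a.
Proof.
have [x ->] := quotP a; have [y ->] := quotP b.
by rewrite !quot_add_cls; apply/clsP.
Qed.

Fact quot_add0 a : quot_add (cls z) a = a.
Proof. by have [x ->] := quotP a; rewrite quot_add_cls; apply/clsP. Qed.

Definition quot_monoid := ComMonoid quot_addA quot_addC quot_add0.

End Quotient.

Section MonoidQuotient.
Variables (M : comMonoid) (N : submonoid M).

Definition msim (m1 m2 : M) : Prop :=
  exists n1 n2, [/\ N n1, N n2 & (m1 + n1 = m2 + n2)%M].

Lemma maddACA (x y z t : M) : (x + y + (z + t) = x + z + (y + t))%M.
Proof. by rewrite -!maddA (maddA y) (maddC y) -(maddA z). Qed.

Lemma msim_congr x x' y y' : msim x x' -> msim y y' ->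
  msim (x + y)%M (x' + y')%M.
Proof.
move=> [n [n' [Nn Nn' E]]] [k [k' [Nk Nk' F]]].
exists (n + k)%M, (n' + k')%M; split; try exact: submonoidD.
by rewrite maddACA E F maddACA.
Qed.

Lemma msim_refl x : msim x x.
Proof. by exists 0%M, 0%M; split => //; apply: submonoid0. Qed.

Lemma msim_equiv : equivalence_prop msim.
Proof.
split; first exact: msim_refl.
- by move=> x y [n [n' [? ? E]]]; exists n', n.
move=> x y z [n [n' [Nn Nn' E]]] [k [k' [Nk Nk' F]]].
exists (n + k)%M, (k' + n')%M; split; try exact: submonoidD.
by rewrite !maddA E -maddA (maddC n') maddA F.
Qed.

Lemma eq_msim x y : x = y -> msim x y.
Proof. by move=> ->; apply: msim_refl. Qed.

Definition mquot : comMonoid :=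
  quot_monoid msim_equiv msim_congr
    (fun x y t => eq_msim (maddA x y t))
    (fun x y => eq_msim (maddC x y))
    (fun x => eq_msim (madd0 x)).

Definition mquot_cls (m : M) : mquot := cls msim m.

Lemma mquot_clsP m1 m2 : mquot_cls m1 = mquot_cls m2 <-> msim m1 m2.
Proof. exact: clsP msim_equiv _ _. Qed.

Lemma mquotP (c : mquot) : exists m, c = mquot_cls m.
Proof. exact: quotP. Qed.

Lemma mquot_clsD m1 m2 :
  mquot_cls (m1 + m2)%M = (mquot_cls m1 + mquot_cls m2)%M.
Proof. by rewrite /= /mquot_cls (quot_add_cls msim_equiv msim_congr). Qed.

End MonoidQuotient.

Section MonoidUnits.
Variable M : comMonoid.

Record unit_elt := UnitElt {
  unit_val :> M;
  unit_valP : exists y, (unit_val + y = 0)%M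
}.

Lemma unit_val_inj (x y : unit_elt) : unit_val x = unit_val y -> x = y.
Proof.
case: x y => [x xP] [y yP] /= E; rewrite E in xP *.
by rewrite (Prop_irrelevance xP yP).
Qed.

Fact unit_zeroP : exists y : M, (0 + y = 0)%M.
Proof. by exists 0%M; rewrite madd0. Qed.

Fact unit_addP (x y : unit_elt) : exists t, (x + y + t = 0)%M.
Proof.
have [[x' ex] [y' ey]] := (unit_valP x, unit_valP y).
by exists (x' + y')%M; rewrite maddACA ex ey madd0.
Qed.

Fact unit_oppP (x : unit_elt) : exists t, (sval (cid (unit_valP x)) + t = 0)%M.
Proof. by exists x; rewrite maddC; case: cid. Qed.

Definition unit_zero := UnitElt unit_zeroP.
Definition unit_add x y := UnitElt (unit_addP x y).
Definition unit_opp x := UnitElt (unit_oppP x).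

Fact unit_addA x y t : unit_add x (unit_add y t) = unit_add (unit_add x y) t.
Proof. by apply: unit_val_inj; rewrite /= maddA. Qed.
Fact unit_addC x y : unit_add x y = unit_add y x.
Proof. by apply: unit_val_inj; rewrite /= maddC. Qed.
Fact unit_add0 x : unit_add unit_zero x = x.
Proof. by apply: unit_val_inj; rewrite /= madd0. Qed.
Fact unit_addN x : unit_add x (unit_opp x) = unit_zero.
Proof. by apply: unit_val_inj => /=; case: cid. Qed.

Definition unit_monoid := ComMonoid unit_addA unit_addC unit_add0.

Definition unit_group : abGroup := @AbGroup unit_monoid unit_opp unit_addN.

End MonoidUnits.

Section LinearOf.
Variables (S : pzRingType) (U V : lmodType S) (h : U -> V) (lin_h : linear h).
HB.instance Definition _ := GRing.isLinear.Build S U V _ h lin_h.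
Definition linear_of : {linear U -> V} := h.
Lemma linear_ofE x : linear_of x = h x. Proof. by []. Qed.
End LinearOf.

Definition finitely_generated (S : pzRingType) (M : lmodType S) : Prop :=
  exists (n : nat) (g : 'I_n -> M),
    forall m : M, exists a : 'I_n -> S, m = \sum_i a i *: g i.

Definition projective (S : pzRingType) (M : lmodType S) : Prop :=
  forall (A B : lmodType S) (p : {linear A -> B}) (f : {linear M -> B}),
    (forall b, exists a, p a = b) ->
    exists h : {linear M -> A}, forall m, p (h m) = f m.

Section FgProjective.
Variable S : pzRingType.

Lemma fg_retract (M N : lmodType S) (p : {linear M -> N}) :
  (forall y, exists x, p x = y) -> finitely_generated M -> finitely_generated N.
Proof.
move=> ps [n [g gP]]; exists n, (p \o g) => y; have [x <-] := ps y.
have [a ->] := gP x; exists a; rewrite linear_sum.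
by apply: eq_bigr => i _; rewrite linearZ.
Qed.

Lemma proj_retract (M N : lmodType S) (p : {linear M -> N})
    (i : {linear N -> M}) :
  cancel i p -> projective M -> projective N.
Proof.
move=> iK Mproj A B g f gs.
have [h hP] := Mproj A B g (f \o p : {linear _ -> _}) gs.
by exists (h \o i : {linear _ -> _}) => y /=; rewrite hP /= iK.
Qed.

Lemma fg_free n : finitely_generated 'rV[S]_n.
Proof.
exists n, (fun i => delta_mx 0 i) => m; exists (m 0).
exact: row_sum_delta.
Qed.

Lemma lincomb_linear (M : lmodType S) n (g : 'I_n -> M) :
  linear (fun v : 'rV[S]_n => \sum_i v 0 i *: g i).
Proof.
move=> a u v; rewrite scaler_sumr -big_split /=.
by apply: eq_bigr => i _; rewrite !mxE scalerDl scalerA.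
Qed.

Definition lincomb (M : lmodType S) n (g : 'I_n -> M) :
  {linear 'rV[S]_n -> M} := linear_of (lincomb_linear g).

Lemma proj_free n : projective 'rV[S]_n.
Proof.
move=> A B p f ps.
pose a i := sval (cid (ps (f (delta_mx 0 i)))).
exists (lincomb a) => v; rewrite linear_ofE linear_sum [in RHS](row_sum_delta v).
rewrite linear_sum; apply: eq_bigr => i _; rewrite !linearZ /a.
by case: cid => x /= ->.
Qed.

Lemma fg_pair (M N : lmodType S) : finitely_generated M ->
  finitely_generated N -> finitely_generated (M * N)%type.
Proof.
move=> [m [g gP]] [n [h hP]]; exists (m + n)%N.
exists (fun k => match split k with inl i => (g i, 0) | inr j => (0, h j) end).
move=> [x y]; have [a ->] := gP x; have [b ->] := hP y.
exists (fun k => match split k with inl i => a i | inr j => b j end).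
have splitl i : split (lshift n i) = inl i :> 'I_m + 'I_n by exact: unsplitK (inl i).
have splitr i : split (rshift m i) = inr i :> 'I_m + 'I_n by exact: unsplitK (inr i).
transitivity (\sum_i a i *: (g i, 0) + \sum_i b i *: (0, h i) : M * N).
  rewrite [RHS]surjective_pairing /= !raddf_sum /=; congr pair.
    by rewrite [X in _ + X]big1 ?addr0// => i _; rewrite scaler0.
  by rewrite [X in X + _]big1 ?add0r// => i _; rewrite scaler0.
rewrite big_split_ord; congr (_ + _); apply: eq_bigr => i _.
  by rewrite splitl.
by rewrite splitr.
Qed.

Lemma pairl_linear (M N : lmodType S) : linear (fun x : M => (x, 0 : N)).
Proof. by move=> a x y; congr pair; rewrite /= scaler0 addr0. Qed.
Lemma pairr_linear (M N : lmodType S) : linear (fun x : N => (0 : M, x)).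
Proof. by move=> a x y; congr pair; rewrite /= scaler0 addr0. Qed.

Lemma proj_pair (M N : lmodType S) : projective M ->
  projective N -> projective (M * N)%type.
Proof.
move=> Mp Np A B p f ps.
have [h hP] := Mp A B p (f \o linear_of (@pairl_linear M N) : {linear _ -> _}) ps.
have [k kP] := Np A B p (f \o linear_of (@pairr_linear M N) : {linear _ -> _}) ps.
have lin : linear (fun x : M * N => h x.1 + k x.2).
  by move=> a x y /=; rewrite !linearP scalerDr addrACA.
exists (linear_of lin) => -[x y]; rewrite linear_ofE linearD hP kP /=.
by rewrite -linearD; congr (f (_, _)); rewrite /= ?addr0 ?add0r.
Qed.

Record fgpModule := FgpModule {
  fgp_mod :> lmodType S;
  fgp_fg : finitely_generated fgp_mod;
  fgp_proj : projective fgp_mod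
}.

Definition fgp_free n := FgpModule (fg_free n) (@proj_free n).

Definition fgp_sum (M N : fgpModule) : fgpModule :=
  FgpModule (fg_pair (@fgp_fg M) (@fgp_fg N))
    (proj_pair (@fgp_proj M) (@fgp_proj N)).

End FgProjective.

Section Kernel.
Variables (S : pzRingType) (V W : lmodType S) (p : {linear V -> W}).

Definition kernel_pred : {pred V} := fun v => p v == 0.

Fact kernel_submod_closed : submod_closed kernel_pred.
Proof.
split=> [|a u v]; rewrite !unfold_in ?linear0//.
by move=> /eqP pu /eqP pv; rewrite linearP pu pv scaler0 addr0.
Qed.

HB.instance Definition _ :=
  GRing.isSubmodClosed.Build S V kernel_pred kernel_submod_closed.

Record kernel := Kernel { kernel_val : V; kernel_valP : kernel_val \in kernel_pred }.

HB.instance Definition _ := [isSub for kernel_val].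
HB.instance Definition _ := [Choice of kernel by <:].
HB.instance Definition _ := [SubChoice_isSubLmodule of kernel by <:].

Variables (i : {linear W -> V}) (iK : cancel i p).

Fact kernel_projP v : v - i (p v) \in kernel_pred.
Proof. by rewrite unfold_in linearB iK subrr. Qed.

Definition kernel_proj (v : V) : kernel := Kernel (kernel_projP v).

Lemma kernel_proj_linear : linear kernel_proj.
Proof.
move=> a u v; apply: val_inj => /=.
by rewrite (linearP p) (linearP i) scalerBr opprD addrACA.
Qed.

Lemma kernel_projK : cancel (val : kernel -> V) kernel_proj.
Proof.
by move=> [v vP]; apply: val_inj => /=; rewrite (eqP vP) linear0 subr0.
Qed.

Lemma kernel_split : exists f : {linear (W * kernel)%type -> V}, bijective f.
Proof.
have lin : linear (fun x : W * kernel => i x.1 + val x.2).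
  by move=> a x y /=; rewrite !linearP scalerDr addrACA.
exists (linear_of lin); exists (fun v => (p v, kernel_proj v)) => [[w k]|v].
  rewrite linear_ofE /=; have pk : p (val k) = 0 by apply/eqP; case: k.
  rewrite linearD iK pk addr0; congr pair; apply: val_inj => /=.
  by rewrite linearD iK pk addr0 addrC addKr.
by rewrite linear_ofE /= addrC subrK.
Qed.

End Kernel.

Section PicardClass.
Variable S : comPzRingType.

Definition fgp_iso (M N : fgpModule S) : Prop :=
  exists f : {linear M -> N}, bijective f.

Lemma linear_inverse (U V : lmodType S) (f : {linear U -> V}) :
  bijective f -> exists2 g : {linear V -> U}, cancel f g & cancel g f.
Proof.
move=> [g fK gK].
have lin : linear g by move=> a x y; apply: (can_inj fK); rewrite linearP !gK.
by exists (linear_of lin).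
Qed.

Lemma fgp_iso_equiv : equivalence_prop fgp_iso.
Proof.
split=> [M|M N [f /linear_inverse[g fK gK]]|M N L [f bf] [g bg]].
- by exists (idfun : {linear _ -> _}); exists idfun.
- by exists g; exists f.
- by exists (g \o f : {linear _ -> _}); apply: bij_comp.
Qed.

Lemma fgp_sum_congr M M' N N' : fgp_iso M M' -> fgp_iso N N' ->
  fgp_iso (fgp_sum M N) (fgp_sum M' N').
Proof.
move=> [f [f' fK f'K]] [g [g' gK g'K]].
have lin : linear (fun x : M * N => (f x.1, g x.2)).
  by move=> a x y /=; rewrite !linearP.
exists (linear_of lin); exists (fun x => (f' x.1, g' x.2)) => -[x y] /=.
  by rewrite fK gK.
by rewrite f'K g'K.
Qed.

Lemma fgp_sumA M N L :
  fgp_iso (fgp_sum M (fgp_sum N L)) (fgp_sum (fgp_sum M N) L).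
Proof.
have lin : linear (fun x : M * (N * L) => ((x.1, x.2.1), x.2.2)) by [].
exists (linear_of lin).
by exists (fun x => (x.1.1, (x.1.2, x.2))) => [[x [y z]]|[[x y] z]].
Qed.

Lemma fgp_sumC M N : fgp_iso (fgp_sum M N) (fgp_sum N M).
Proof.
have lin : linear (fun x : M * N => (x.2, x.1)) by [].
by exists (linear_of lin); exists (fun x => (x.2, x.1)) => -[x y].
Qed.

Lemma fgp_sum0 M : fgp_iso (fgp_sum (fgp_free S 0) M) M.
Proof.
exists (snd : {linear ('rV[S]_0 * M)%type -> M}).
by exists (pair 0) => [[x y]|//]; rewrite [x]thinmx0.
Qed.

Definition monP : comMonoid :=
  quot_monoid fgp_iso_equiv fgp_sum_congr fgp_sumA fgp_sumC fgp_sum0.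

Definition monP_cls (M : fgpModule S) : monP := cls fgp_iso M.

Lemma monP_clsP M N : monP_cls M = monP_cls N <-> fgp_iso M N.
Proof. exact: clsP fgp_iso_equiv _ _. Qed.

Lemma monP_clsD M N : monP_cls (fgp_sum M N) = (monP_cls M + monP_cls N)%M.
Proof. by rewrite /= /monP_cls (quot_add_cls fgp_iso_equiv fgp_sum_congr). Qed.

Definition is_free_cls (c : monP) : Prop := exists n, c = monP_cls (fgp_free S n).

Fact is_free_cls0 : is_free_cls 0%M. Proof. by exists 0%N. Qed.

Lemma free_sum_linear m n :
  linear (fun x : 'rV[S]_m * 'rV[S]_n => row_mx x.1 x.2).
Proof. by move=> a x y; rewrite /= -add_row_mx scale_row_mx. Qed.

Fact is_free_clsD x y : is_free_cls x -> is_free_cls y -> is_free_cls (x + y)%M.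
Proof.
move=> [m ->] [n ->]; exists (m + n)%N; rewrite -monP_clsD; apply/monP_clsP.
exists (linear_of (@free_sum_linear m n)).
exists (fun v => (lsubmx v, rsubmx v)) => [[u w]|v].
  by rewrite linear_ofE /= row_mxKl row_mxKr.
by rewrite linear_ofE /= hsubmxK.
Qed.

Definition monF : submonoid monP := Submonoid is_free_cls0 is_free_clsD.

Definition PC_monoid : comMonoid := mquot monF.

(* Complements of modules in free ones supply the opposites in P(S)/F(S). *)
Lemma fgp_complement (M : fgpModule S) :
  exists N n, fgp_iso (fgp_sum M N) (fgp_free S n).
Proof.
have [n [g gP]] := fgp_fg M.
have gs m : exists v, lincomb g v = m.
  have [a ->] := gP m; exists (\row_i a i); rewrite linear_ofE.
  by apply: eq_bigr => i _; rewrite mxE.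
have [s sK] := @fgp_proj S M _ _ (lincomb g) (idfun : {linear _ -> _}) gs.
have psurj k : exists v, linear_of (kernel_proj_linear sK) v = k.
  by exists (val k); apply: kernel_projK.
pose N := FgpModule (fg_retract psurj (fg_free S n))
  (@proj_retract _ _ _ (linear_of (kernel_proj_linear sK))
     (val : {linear kernel (lincomb g) -> 'rV_n})
     (kernel_projK sK) (@proj_free S n)).
by exists N, n; apply: kernel_split sK.
Qed.

Fact PC_oppP (x : PC_monoid) : exists y, (x + y = 0)%M.
Proof.
have [c ->] := mquotP x; have [M ->] := quotP c.
have [N [n iso]] := fgp_complement M.
exists (mquot_cls monF (monP_cls N)); rewrite -mquot_clsD -monP_clsD.
apply/mquot_clsP; exists 0%M, (monP_cls (fgp_free S n)); split.
- exact: submonoid0.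
- by exists n.
- by rewrite madd0 maddC madd0; apply/monP_clsP.
Qed.

Definition PC : abGroup :=
  @AbGroup PC_monoid (fun x => sval (cid (PC_oppP x)))
    (fun x => svalP (cid (PC_oppP x))).

Definition PC_cls (M : fgpModule S) : PC := mquot_cls monF (monP_cls M).

End PicardClass.

(* Rings are ComPzRing, so that the zero ring is allowed. *)
HB.mixin Record ComPzRing_isDifferential R of GRing.ComPzRing R := {
  deriv : R -> R;
  derivD : forall x y : R, deriv (x + y) = deriv x + deriv y;
  derivM : forall x y : R, deriv (x * y) = deriv x * y + x * deriv y
}.

#[short(type="diffRingType")]
HB.structure Definition DiffRing :=
  {R of ComPzRing_isDifferential R & GRing.ComPzRing R}.

Section Constants.
Variable R : diffRingType.

Lemma deriv0 : deriv (0 : R) = 0.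
Proof. by apply: (addrI (deriv 0)); rewrite -derivD !addr0. Qed.

Lemma derivN (x : R) : deriv (- x) = - deriv x.
Proof. by apply: (addrI (deriv x)); rewrite -derivD !subrr deriv0. Qed.

Lemma deriv1 : deriv (1 : R) = 0.
Proof. by apply: (addrI (deriv 1)); rewrite -{3}[1]mulr1 derivM mulr1 mul1r addr0. Qed.

Definition constant_pred : {pred R} := fun x => deriv x == 0.

Fact constant_subring_closed : subring_closed constant_pred.
Proof.
split=> [|x y /eqP dx /eqP dy|x y /eqP dx /eqP dy]; apply/eqP.
- exact: deriv1.
- by rewrite derivD derivN dx dy subrr.
- by rewrite derivM dx dy mul0r mulr0 addr0.
Qed.

Record constants := Constant {
  constant_val : R;
  constant_valP : constant_val \in constant_pred
}.

HB.instance Definition _ := [isSub for constant_val].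
HB.instance Definition _ := [Choice of constants by <:].
HB.instance Definition _ := GRing.SubChoice_isSubComPzRing.Build R constant_pred
  constants constant_subring_closed.

Lemma deriv_constant (c : constants) : deriv (val c) = 0.
Proof. by case: c => c cP; apply/eqP. Qed.

End Constants.

(* [restr f B] is B with scalars restricted along f : S -> R. *)
Definition restr (S R : pzRingType) (f : {rmorphism S -> R}) (B : Type) := B.

Section Restriction.
Variables (S R : pzRingType) (f : {rmorphism S -> R}) (B : lmodType R).

HB.instance Definition _ := GRing.Zmodule.on (restr f B).

Definition restr_scale (s : S) (b : restr f B) : restr f B := f s *: (b : B).

Fact restr_scaleA a b v : restr_scale a (restr_scale b v) = restr_scale (a * b) v.
Proof. by rewrite /restr_scale scalerA rmorphM. Qed.
Fact restr_scale1 : left_id 1 restr_scale.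
Proof. by move=> v; rewrite /restr_scale rmorph1 scale1r. Qed.
Fact restr_scaleDr : right_distributive restr_scale +%R.
Proof. by move=> a u v; rewrite /restr_scale scalerDr. Qed.
Fact restr_scaleDl v : {morph restr_scale^~ v : a b / a + b}.
Proof. by move=> a b; rewrite /restr_scale rmorphD scalerDl. Qed.

HB.instance Definition _ := GRing.Zmodule_isLmodule.Build S (restr f B)
  restr_scaleA restr_scale1 restr_scaleDr restr_scaleDl.

End Restriction.

(* The tensor product R ⊗_S N along f : S -> R: formal sums of pairs (r, x),
   modulo the congruence generated by the bilinearity relations. *)
Section Tensor.
Variables (S R : comPzRingType) (f : {rmorphism S -> R}) (N : lmodType S).

Inductive tensor_rel : seq (R * N) -> seq (R * N) -> Prop :=
| tensor_refl t : tensor_rel t t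
| tensor_sym t u : tensor_rel t u -> tensor_rel u t
| tensor_trans t u v : tensor_rel t u -> tensor_rel u v -> tensor_rel t v
| tensor_cat t t' u u' : tensor_rel t t' -> tensor_rel u u' ->
    tensor_rel (t ++ u) (t' ++ u')
| tensor_catC t u : tensor_rel (t ++ u) (u ++ t)
| tensor_zero x : tensor_rel [:: (0, x)] [::]
| tensor_addl r r' x : tensor_rel [:: (r + r', x)] [:: (r, x); (r', x)]
| tensor_addr r x x' : tensor_rel [:: (r, x + x')] [:: (r, x); (r, x')]
| tensor_scale r s x : tensor_rel [:: (r * f s, x)] [:: (r, s *: x)].

Definition tensor_relb : rel (seq (R * N)) := fun t u => `[< tensor_rel t u >].

Fact tensor_relb_refl : reflexive tensor_relb.
Proof. by move=> t; apply/asboolP; apply: tensor_refl. Qed.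
Fact tensor_relb_sym : symmetric tensor_relb.
Proof. by move=> t u; apply/asboolP/asboolP; apply: tensor_sym. Qed.
Fact tensor_relb_trans : transitive tensor_relb.
Proof.
by move=> u t v /asboolP tu /asboolP uv; apply/asboolP; apply: tensor_trans tu uv.
Qed.

Canonical tensor_equiv :=
  EquivRel tensor_relb tensor_relb_refl tensor_relb_sym tensor_relb_trans.

Definition tensor := {eq_quot tensor_relb}.
HB.instance Definition _ := Choice.on tensor.
HB.instance Definition _ := EqQuotient.on tensor.

Definition tpi (t : seq (R * N)) : tensor := \pi_tensor t.

Definition tprod (r : R) (x : N) : tensor := tpi [:: (r, x)].

Lemma tpiP t u : tpi t = tpi u <-> tensor_rel t u.
Proof.
split=> [/eqP|tu]; last by apply/eqP; rewrite /tpi piE; apply/asboolP.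
by rewrite /tpi piE => /asboolP.
Qed.

Lemma tpi_repr c : exists t, c = tpi t.
Proof. by exists (repr c); rewrite /tpi reprK. Qed.

Lemma tensor_reprP t : tensor_rel (repr (tpi t)) t.
Proof. by apply/tpiP; rewrite /tpi reprK. Qed.

(* g ⊗ id for an S-linear g : R -> R; a junk value for other g. *)
Definition tlift_seq (g : R -> R) (t : seq (R * N)) : seq (R * N) :=
  [seq (g x.1, x.2) | x <- t].

Definition tlift (g : R -> R) (c : tensor) : tensor := tpi (tlift_seq g (repr c)).

Definition S_linear (g : R -> R) : Prop :=
  (forall r r', g (r + r') = g r + g r') /\
  (forall r s, g (r * f s) = g r * f s).

Lemma tlift_rel g t u : S_linear g -> tensor_rel t u ->
  tensor_rel (tlift_seq g t) (tlift_seq g u).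
Proof.
move=> [gD gf] tu.
have g0 : g 0 = 0 by apply: (addrI (g 0)); rewrite -gD !addr0.
elim: tu => {t u} [t|t u _|t u v _ tu _|t t' u u' _ tt' _ uu'|t u|x|r r' x|r x x'|r s x].
- exact: tensor_refl.
- exact: tensor_sym.
- exact: tensor_trans tu.
- by rewrite /tlift_seq !map_cat; apply: tensor_cat.
- by rewrite /tlift_seq !map_cat; apply: tensor_catC.
- by rewrite /= g0; apply: tensor_zero.
- by rewrite /= gD; apply: tensor_addl.
- exact: tensor_addr.
- by rewrite /= gf; apply: tensor_scale.
Qed.

Lemma tlift_tpi g t : S_linear g -> tlift g (tpi t) = tpi (tlift_seq g t).
Proof. by move=> gS; apply/tpiP; apply: tlift_rel => //; apply: tensor_reprP. Qed.

Definition tadd (a b : tensor) : tensor := tpi (repr a ++ repr b).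

Lemma tadd_tpi t u : tadd (tpi t) (tpi u) = tpi (t ++ u).
Proof. by apply/tpiP; apply: tensor_cat; apply: tensor_reprP. Qed.

Fact taddA : associative tadd.
Proof.
move=> a b c; have [t ->] := tpi_repr a; have [u ->] := tpi_repr b.
by have [v ->] := tpi_repr c; rewrite !tadd_tpi catA.
Qed.

Fact taddC : commutative tadd.
Proof.
move=> a b; have [t ->] := tpi_repr a; have [u ->] := tpi_repr b.
by rewrite !tadd_tpi; apply/tpiP; apply: tensor_catC.
Qed.

Fact tadd0 : left_id (tpi [::]) tadd.
Proof. by move=> a; have [t ->] := tpi_repr a; rewrite tadd_tpi. Qed.

Fact S_linear_opp : S_linear (@GRing.opp R).
Proof. by split=> [r r'|r s]; rewrite ?opprD ?mulNr. Qed.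

Lemma tpi_cons x t : tpi (x :: t) = tadd (tpi [:: x]) (tpi t).
Proof. by rewrite tadd_tpi. Qed.

Lemma tprodDl r r' x : tprod (r + r') x = tadd (tprod r x) (tprod r' x).
Proof. by rewrite tadd_tpi; apply/tpiP; apply: tensor_addl. Qed.

Fact taddN : left_inverse (tpi [::]) (tlift -%R) tadd.
Proof.
move=> a; have [t ->] := tpi_repr a; rewrite (tlift_tpi _ S_linear_opp).
elim: t => [|[r x] t IHt]; first by rewrite tadd_tpi.
rewrite /= [X in tadd X _]tpi_cons [X in tadd _ X]tpi_cons.
have addACA p q u v : tadd (tadd p q) (tadd u v) = tadd (tadd p u) (tadd q v).
  by rewrite -!taddA (taddA q) (taddC q) -(taddA u).
rewrite addACA IHt taddC tadd0 -tprodDl addNr.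
by apply/tpiP; apply: tensor_zero.
Qed.

HB.instance Definition _ := GRing.isZmodule.Build tensor taddA taddC tadd0 taddN.

Lemma tpiD t u : tpi (t ++ u) = tpi t + tpi u.
Proof. by rewrite -tadd_tpi. Qed.

Lemma tlift_tprod g r x : S_linear g -> tlift g (tprod r x) = tprod (g r) x.
Proof. by move=> gS; rewrite tlift_tpi. Qed.

Lemma tliftD g a b : S_linear g -> tlift g (a + b) = tlift g a + tlift g b.
Proof.
move=> gS; have [t ->] := tpi_repr a; have [u ->] := tpi_repr b.
by rewrite -tpiD !tlift_tpi // /tlift_seq map_cat tpiD.
Qed.

Lemma tlift0 g : S_linear g -> tlift g 0 = 0.
Proof. by move=> gS; rewrite [LHS](tlift_tpi [::] gS). Qed.

Lemma tensor_ind (Q : tensor -> Prop) :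
  Q 0 -> (forall a b, Q a -> Q b -> Q (a + b)) -> (forall r x, Q (tprod r x)) ->
  forall c, Q c.
Proof.
move=> Q0 QD Qt c; have [t ->] := tpi_repr c.
elim: t => [|[r x] t IHt]; first exact: Q0.
by rewrite -cat1s tpiD; apply: QD => //; apply: Qt.
Qed.

Fact S_linear_mul a : S_linear (fun r => a * r).
Proof. by split=> [r r'|r s]; rewrite ?mulrDr ?mulrA. Qed.

Definition tscale (a : R) (c : tensor) : tensor := tlift (fun r => a * r) c.

Lemma tscale_tprod a r x : tscale a (tprod r x) = tprod (a * r) x.
Proof. exact: tlift_tprod (S_linear_mul a). Qed.

Fact tscaleDr : right_distributive tscale +%R.
Proof. by move=> a u v; apply: tliftD (S_linear_mul a). Qed.

Lemma tscale0 a : tscale a 0 = 0.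
Proof. exact: tlift0 (S_linear_mul a). Qed.

Fact tscaleA a b c : tscale a (tscale b c) = tscale (a * b) c.
Proof.
elim/tensor_ind: c => [|u v Eu Ev|r x]; first by rewrite !tscale0.
  by rewrite !tscaleDr Eu Ev.
by rewrite !tscale_tprod mulrA.
Qed.

Fact tscale1 : left_id 1 tscale.
Proof.
elim/tensor_ind => [|u v Eu Ev|r x]; first by rewrite !tscale0.
  by rewrite !tscaleDr Eu Ev.
by rewrite !tscale_tprod mul1r.
Qed.

Fact tscaleDl c : {morph tscale^~ c : a b / a + b}.
Proof.
move=> a b; elim/tensor_ind: c => [|u v Eu Ev|r x].
- by rewrite !tscale0 addr0.
- by rewrite !tscaleDr Eu Ev addrACA.
- by rewrite !tscale_tprod mulrDl tprodDl.
Qed.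

HB.instance Definition _ := GRing.Zmodule_isLmodule.Build R tensor
  tscaleA tscale1 tscaleDr tscaleDl.

Lemma scale_tprod a r x : a *: tprod r x = tprod (a * r) x.
Proof. exact: tscale_tprod. Qed.

Lemma tprodE r x : tprod r x = r *: tprod 1 x.
Proof. by rewrite scale_tprod mulr1. Qed.

Lemma tprodDr r x y : tprod r (x + y) = tprod r x + tprod r y.
Proof. by rewrite -tpiD; apply/tpiP; apply: tensor_addr. Qed.

Lemma tprodZ r s x : tprod r (s *: x) = tprod (r * f s) x.
Proof. by apply/tpiP; apply: tensor_sym; apply: tensor_scale. Qed.

Lemma tprod1_linear : linear (tprod 1 : N -> restr f tensor).
Proof.
by move=> a x y; rewrite tprodDr tprodZ mul1r [tprod (f a) x]tprodE.
Qed.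

Section Extension.
Variables (B : lmodType R) (h : {linear N -> restr f B}).

Definition text_seq (t : seq (R * N)) : B := \sum_(x <- t) x.1 *: (h x.2 : B).

Lemma text_rel t u : tensor_rel t u -> text_seq t = text_seq u.
Proof.
elim=> {t u} [//|//|t u v _ -> _ -> //|t t' u u' _ E _ E'|t u|x|r r' x|r x x'|r s x].
- by rewrite /text_seq !big_cat /= -!/(text_seq _) E E'.
- by rewrite /text_seq !big_cat /= addrC.
- by rewrite /text_seq big_seq1 big_nil scale0r.
- by rewrite /text_seq !big_cons big_nil !addr0 scalerDl.
- by rewrite /text_seq !big_cons big_nil !addr0 /= linearD scalerDr.
- by rewrite /text_seq !big_seq1 /= linearZ /= -scalerA.
Qed.

Definition text_fun (c : tensor) : B := text_seq (repr c).

Lemma text_tpi t : text_fun (tpi t) = text_seq t.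
Proof. by apply: text_rel; apply: tensor_reprP. Qed.

Lemma text_tprod r x : text_fun (tprod r x) = r *: (h x : B).
Proof. by rewrite text_tpi /text_seq big_seq1. Qed.

Lemma text_funD a b : text_fun (a + b) = text_fun a + text_fun b.
Proof.
have [t ->] := tpi_repr a; have [u ->] := tpi_repr b.
by rewrite -tpiD !text_tpi /text_seq big_cat.
Qed.

Lemma text_linear : linear text_fun.
Proof.
move=> a u v; rewrite text_funD; congr (_ + _).
elim/tensor_ind: u => [|c d Ec Ed|r x].
- have E : text_fun 0 = 0 by apply: (addrI (text_fun 0)); rewrite -text_funD !addr0.
  by rewrite scaler0 E scaler0.
- by rewrite scalerDr !text_funD Ec Ed scalerDr.
- by rewrite scale_tprod !text_tprod scalerA.
Qed.

Definition text : {linear tensor -> B} := linear_of text_linear.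

End Extension.

Lemma tensor_fg : finitely_generated N -> finitely_generated tensor.
Proof.
move=> [n [g gP]]; exists n, (fun i => tprod 1 (g i)).
elim/tensor_ind => [|c d [a ->] [b ->]|r x].
- by exists (fun=> 0); rewrite big1 // => i _; rewrite scale0r.
- exists (fun i => a i + b i); rewrite -big_split /=.
  by apply: eq_bigr => i _; rewrite scalerDl.
have [a ->] := gP x; exists (fun i => r * f (a i)).
rewrite tprodE -[tprod 1 _]/(linear_of tprod1_linear _) linear_sum.
rewrite scaler_sumr; apply: eq_bigr => i _; rewrite linearZ.
by rewrite -scalerA.
Qed.

Lemma tensor_proj : projective N -> projective tensor.
Proof.
move=> Np A B p g ps.
have linp : linear (p : restr f A -> restr f B).
  by move=> a x y; apply: (linearP p).
have ling : linear ((g : tensor -> B) \o tprod 1 : N -> restr f B).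
  by move=> a x y /=; rewrite (tprod1_linear a x y); apply: (linearP g).
have [h hP] := Np _ _ (linear_of linp) (linear_of ling) ps.
exists (text h); elim/tensor_ind => [|c d Ec Ed|r x].
- by rewrite !linear0.
- by rewrite !linearD Ec Ed.
rewrite linear_ofE text_tprod linearZ /= tprodE linearZ /=.
by congr (_ *: _); apply: hP.
Qed.

End Tensor.

Section DiffModules.
Variable R : diffRingType.

Record diffModule := DiffModule {
  dm_fgp :> fgpModule R;
  dm_der : dm_fgp -> dm_fgp;
  dm_derD : forall x y, dm_der (x + y) = dm_der x + dm_der y;
  dm_derZ : forall (r : R) x, dm_der (r *: x) = deriv r *: x + r *: dm_der x
}.

Definition diff_iso (M N : diffModule) : Prop :=
  exists2 f : {linear M -> N}, bijective f &
    forall x, f (dm_der x) = dm_der (f x).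

Lemma diff_iso_equiv : equivalence_prop diff_iso.
Proof.
split=> [M|M N [f /linear_inverse[g fK gK] fD]|M N L [f bf fD] [g bg gD]].
- by exists (idfun : {linear _ -> _}) => //; exists idfun.
- exists g; first by exists f.
  by move=> x; apply: (can_inj fK); rewrite fD !gK.
- exists (g \o f : {linear _ -> _}); first exact: bij_comp.
  by move=> x /=; rewrite fD gD.
Qed.

Section Sum.
Variables M N : diffModule.
Definition dm_sum_der (x : fgp_sum M N) : fgp_sum M N := (dm_der x.1, dm_der x.2).
Fact dm_sumD x y : dm_sum_der (x + y) = dm_sum_der x + dm_sum_der y.
Proof. by rewrite /dm_sum_der /= !dm_derD. Qed.
Fact dm_sumZ (r : R) x : dm_sum_der (r *: x) = deriv r *: x + r *: dm_sum_der x.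
Proof. by rewrite /dm_sum_der /= !dm_derZ. Qed.
Definition dm_sum : diffModule := DiffModule dm_sumD dm_sumZ.
End Sum.

Section Trivial.
Variable n : nat.
Definition dm_free_der (v : fgp_free R n) : fgp_free R n := map_mx deriv (v : 'rV[R]_n).
Fact dm_freeD x y : dm_free_der (x + y) = dm_free_der x + dm_free_der y.
Proof. by apply/rowP => i; rewrite !mxE derivD. Qed.
Fact dm_freeZ (r : R) x : dm_free_der (r *: x) = deriv r *: x + r *: dm_free_der x.
Proof. by apply/rowP => i; rewrite !mxE derivM. Qed.
Definition dm_free : diffModule := DiffModule dm_freeD dm_freeZ.
End Trivial.

Lemma dm_sum_congr M M' N N' : diff_iso M M' -> diff_iso N N' ->
  diff_iso (dm_sum M N) (dm_sum M' N').
Proof.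
move=> [f [f' fK f'K] fD] [g [g' gK g'K] gD].
have lin : linear (fun x : M * N => (f x.1, g x.2)).
  by move=> a x y /=; rewrite !linearP.
exists (linear_of lin); last by move=> [x y] /=; rewrite /dm_sum_der /= fD gD.
exists (fun x => (f' x.1, g' x.2)) => -[x y] /=; first by rewrite fK gK.
by rewrite f'K g'K.
Qed.

Lemma dm_sumA M N L :
  diff_iso (dm_sum M (dm_sum N L)) (dm_sum (dm_sum M N) L).
Proof.
have lin : linear (fun x : M * (N * L) => ((x.1, x.2.1), x.2.2)) by [].
exists (linear_of lin) => //.
by exists (fun x => (x.1.1, (x.1.2, x.2))) => [[x [y z]]|[[x y] z]].
Qed.

Lemma dm_sumC M N : diff_iso (dm_sum M N) (dm_sum N M).
Proof.
have lin : linear (fun x : M * N => (x.2, x.1)) by [].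
by exists (linear_of lin) => //; exists (fun x => (x.2, x.1)) => -[x y].
Qed.

Lemma dm_sum0 M : diff_iso (dm_sum (dm_free 0) M) M.
Proof.
exists (snd : {linear ('rV[R]_0 * M)%type -> M}) => //.
by exists (pair 0) => [[x y]|//]; rewrite [x]thinmx0.
Qed.

Definition monPdiff : comMonoid :=
  quot_monoid diff_iso_equiv dm_sum_congr dm_sumA dm_sumC dm_sum0.

Definition monPdiff_cls (M : diffModule) : monPdiff := cls diff_iso M.

Lemma monPdiff_clsP M N : monPdiff_cls M = monPdiff_cls N <-> diff_iso M N.
Proof. exact: clsP diff_iso_equiv _ _. Qed.

Lemma monPdiff_clsD M N :
  monPdiff_cls (dm_sum M N) = (monPdiff_cls M + monPdiff_cls N)%M.
Proof. by rewrite /= /monPdiff_cls (quot_add_cls diff_iso_equiv dm_sum_congr). Qed.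

Definition is_trivial_cls (c : monPdiff) : Prop :=
  exists n, c = monPdiff_cls (dm_free n).

Fact is_trivial_cls0 : is_trivial_cls 0%M. Proof. by exists 0%N. Qed.

Fact is_trivial_clsD x y : is_trivial_cls x -> is_trivial_cls y ->
  is_trivial_cls (x + y)%M.
Proof.
move=> [m ->] [n ->]; exists (m + n)%N; rewrite -monPdiff_clsD.
apply/monPdiff_clsP; exists (linear_of (@free_sum_linear R m n)).
  exists (fun v => (lsubmx v, rsubmx v)) => [[u w]|v].
    by rewrite linear_ofE /= row_mxKl row_mxKr.
  by rewrite linear_ofE /= hsubmxK.
by move=> [u w]; rewrite linear_ofE /= /dm_free_der map_row_mx.
Qed.

Definition monF0diff : submonoid monPdiff :=
  Submonoid is_trivial_cls0 is_trivial_clsD.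

Definition PCdiff : comMonoid := mquot monF0diff.

Definition PCdiff_cls (M : diffModule) : PCdiff :=
  mquot_cls monF0diff (monPdiff_cls M).

End DiffModules.

Definition incl (R : diffRingType) : {rmorphism constants R -> R} := val.

Section BaseChange.
Variables (R : diffRingType) (P0 : fgpModule (constants R)).

Notation incl := (incl R).

Definition base_change : fgpModule R :=
  FgpModule (tensor_fg incl (@fgp_fg _ P0))
    (@tensor_proj _ _ incl _ (@fgp_proj _ P0)).

Fact deriv_S_linear : S_linear incl (@deriv R).
Proof.
split=> [|r s]; first exact: derivD.
by rewrite derivM deriv_constant mulr0 addr0.
Qed.

(* D_R ⊗ id: apply deriv to the left factors; this respects the tensor
   relations because constants have derivative 0. *)
Definition base_change_der (c : base_change) : base_change := tlift deriv c.

Fact base_change_derD x y :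
  base_change_der (x + y) = base_change_der x + base_change_der y.
Proof. exact: tliftD deriv_S_linear. Qed.

Fact base_change_derZ (r : R) x :
  base_change_der (r *: x) = deriv r *: x + r *: base_change_der x.
Proof.
have der_tprod a y : base_change_der (tprod incl a y) = tprod incl (deriv a) y.
  exact: tlift_tprod deriv_S_linear.
elim/tensor_ind: x => [|u v Eu Ev|a y].
- have -> : base_change_der 0 = 0 by apply: tlift0 deriv_S_linear.
  by rewrite !scaler0 addr0; apply: tlift0 deriv_S_linear.
- by rewrite !scalerDr !base_change_derD Eu Ev scalerDr addrACA.
- by rewrite der_tprod !scale_tprod der_tprod derivM tprodDl.
Qed.

Definition base_change_diff : diffModule R :=
  DiffModule base_change_derD base_change_derZ.

End BaseChange.

(* Main.v *)
From mathcomp Require Import all_boot all_algebra boolp.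
Require Import Defs.

(* A module is a unit of PC^diff(R) exactly when it is a differential retract
   of some (R^n, 0).  On such retracts M, taking constants M |-> M^D is inverse
   to base change: the constants of R^n are (R^D)^n, so M^D is a retract of
   (R^D)^n, and the maps P0 -> (R ⊗ P0)^D and R ⊗ M^D -> M are isomorphisms
   because they are retracts of the corresponding maps for free modules.  The
   first isomorphism gives injectivity of q, the second surjectivity. *)

Set Implicit Arguments.
Unset Strict Implicit.
Unset Printing Implicit Defensive.

Import GRing.Theory.

Local Open Scope ring_scope.

(** * Linear maps between extensions of scalars *)

Section TensorMaps.
Variables (S R : comPzRingType) (f : {rmorphism S -> R}).

(** The elements $1 ⊗ x$ generate $R ⊗ N$ over $R$. This reduces every later identity between maps
    out of a tensor product to these elements. *)
Lemma tensor_linear_eq (N : lmodType S) (B : lmodType R)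
    (g h : {linear tensor f N -> B}) :
  (forall x, g (tprod f 1 x) = h (tprod f 1 x)) -> g =1 h.
Proof.
move=> gh; elim/tensor_ind => [|c d Ec Ed|r x]; first by rewrite !linear0.
  by rewrite !linearD Ec Ed.
by rewrite tprodE !linearZ gh.
Qed.

Lemma tensor_comp_eq (N : lmodType S) (B C : lmodType R)
    (g : {linear tensor f N -> B}) (k : {linear B -> C}) (h : {linear tensor f N -> C}) :
  (forall x, k (g (tprod f 1 x)) = h (tprod f 1 x)) -> forall c, k (g c) = h c.
Proof. exact: tensor_linear_eq (k \o g : {linear _ -> _}) h. Qed.

Lemma tensor_cancel (N : lmodType S) (B : lmodType R)
    (g : {linear tensor f N -> B}) (k : {linear B -> tensor f N}) :
  (forall x, k (g (tprod f 1 x)) = tprod f 1 x) -> cancel g k.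
Proof. exact: tensor_comp_eq (idfun : {linear _ -> _}). Qed.

Lemma text_tprod1 (N : lmodType S) (B : lmodType R) (h : {linear N -> restr f B}) x :
  text h (tprod f 1 x) = h x.
Proof. by rewrite linear_ofE text_tprod scale1r. Qed.

Lemma tprod0 (N : lmodType S) r : tprod f r (0 : N) = 0.
Proof. by apply: (addrI (tprod f r 0)); rewrite -tprodDr !addr0. Qed.

Lemma tprod1Z (N : lmodType S) s (x : N) :
  tprod f 1 (s *: x) = f s *: tprod f 1 x.
Proof. by rewrite tprodZ mul1r [LHS]tprodE. Qed.

Lemma tprod1_sum (N : lmodType S) n (x : 'I_n -> N) :
  tprod f 1 (\sum_i x i) = \sum_i tprod f 1 (x i).
Proof. exact: (linear_sum (linear_of (@tprod1_linear _ _ f N))). Qed.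

Lemma map_mx_restr_linear n : linear (map_mx f : 'rV[S]_n -> restr f 'rV[R]_n).
Proof. by move=> a u v; apply/rowP => i; rewrite !mxE rmorphD rmorphM. Qed.

(** The map $S^n → R^n$ whose extension by [text] is the canonical isomorphism $R ⊗ S^n ≅ R^n$. *)
Definition map_mx_restr n := linear_of (@map_mx_restr_linear n).

Lemma copair_linear (U V B : lmodType R) (g : {linear U -> B}) (h : {linear V -> B}) :
  linear (fun x : U * V => g x.1 + h x.2).
Proof. by move=> a x y /=; rewrite !linearP scalerDr addrACA. Qed.

Lemma tensor_map_linear (N N' : lmodType S) (u : {linear N -> N'}) :
  linear (fun x => tprod f 1 (u x) : restr f (tensor f N')).
Proof. by move=> a x y; rewrite linearP; apply: tprod1_linear. Qed.

(** This is $\mathrm{id}_R ⊗ u$. *)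
Definition tensor_map (N N' : lmodType S) (u : {linear N -> N'}) :=
  text (linear_of (tensor_map_linear u)).

Lemma tensor_map_tprod (N N' : lmodType S) (u : {linear N -> N'}) x :
  tensor_map u (tprod f 1 x) = tprod f 1 (u x).
Proof. exact: text_tprod1. Qed.

Lemma tensor_map_cancel (N N' : lmodType S) (u : {linear N -> N'})
    (v : {linear N' -> N}) :
  cancel u v -> cancel (tensor_map u) (tensor_map v).
Proof.
by move=> uK; apply: tensor_cancel => x; rewrite !tensor_map_tprod uK.
Qed.

Lemma tensor_pair_linear (N N' : lmodType S) :
  linear (fun x : N * N' => (tprod f 1 x.1, tprod f 1 x.2)
    : restr f (tensor f N * tensor f N')%type).
Proof. by move=> a x y; congr pair; apply: tprod1_linear. Qed.

Definition tensor_pair (N N' : lmodType S) :=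
  text (linear_of (@tensor_pair_linear N N')).

Lemma tensor_pair_tprod (N N' : lmodType S) x y :
  tensor_pair N N' (tprod f 1 (x, y)) = (tprod f 1 x, tprod f 1 y).
Proof. exact: text_tprod1. Qed.

(** The inverse extends scalars in the two injections into $N × N'$ and adds the results. *)
Lemma tensor_pair_bij (N N' : lmodType S) : bijective (tensor_pair N N').
Proof.
pose g := copair_linear (tensor_map (linear_of (@pairl_linear S N N')))
  (tensor_map (linear_of (@pairr_linear S N N'))).
exists (linear_of g).
  apply: tensor_cancel => -[x y]; rewrite tensor_pair_tprod linear_ofE !tensor_map_tprod.
  by rewrite -tprodDr; congr (tprod _ _ (_, _)); rewrite /= ?addr0 ?add0r.
move=> [c d]; rewrite linear_ofE linearD.
have -> : tensor_pair N N' (tensor_map (linear_of (@pairl_linear S N N')) c) = (c, 0).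
  apply: (tensor_comp_eq (h := linear_of (@pairl_linear _ _ _))) => x.
  by rewrite tensor_map_tprod tensor_pair_tprod tprod0.
have -> : tensor_pair N N' (tensor_map (linear_of (@pairr_linear S N N')) d) = (0, d).
  apply: (tensor_comp_eq (h := linear_of (@pairr_linear _ _ _))) => x.
  by rewrite tensor_map_tprod tensor_pair_tprod tprod0.
by congr pair; rewrite /= ?addr0 ?add0r.
Qed.

(** The inverse sends the basis vector $e_j$ of $R^n$ to $1 ⊗ e_j$. *)
Lemma tensor_free_bij n : bijective (text (map_mx_restr n)).
Proof.
exists (lincomb (fun j => tprod f 1 (delta_mx 0 j))).
  apply: tensor_cancel => v; rewrite text_tprod1 [in RHS](row_sum_delta v) tprod1_sum.
  by apply: eq_bigr => i _; rewrite tprod1Z !mxE.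
move=> v; rewrite [LHS]linear_sum [RHS]row_sum_delta; apply: eq_bigr => i _.
rewrite linearZ; congr (_ *: _); rewrite text_tprod1.
by apply/rowP => j; rewrite !mxE rmorph_nat.
Qed.

End TensorMaps.

(** * Retracts of free modules and stable isomorphism *)

Section FgpRetract.
Variable S : comPzRingType.

Lemma fgp_free_retract (P : fgpModule S) :
  exists n (i : {linear P -> 'rV[S]_n}) (p : {linear 'rV[S]_n -> P}), cancel i p.
Proof.
have [N [n [g /linear_inverse[h gK hK]]]] := fgp_complement P.
exists n, (g \o linear_of (@pairl_linear S P N) : {linear _ -> _}).
by exists ((fst : {linear (P * N)%type -> P}) \o h : {linear _ -> _}) => x /=; rewrite gK.
Qed.

Lemma PC_clsP (P Q : fgpModule S) : PC_cls P = PC_cls Q <->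
  exists m n, fgp_iso (fgp_sum P (fgp_free S m)) (fgp_sum Q (fgp_free S n)).
Proof.
split=> [/mquot_clsP[_ [_ [[m ->] [n ->]]]]|[m [n iso]]].
  by rewrite -!monP_clsD => /monP_clsP; exists m, n.
apply/mquot_clsP; exists (monP_cls (fgp_free S m)), (monP_cls (fgp_free S n)).
by split; [exists m|exists n|rewrite -!monP_clsD; apply/monP_clsP].
Qed.

Lemma PC_clsD (P Q : fgpModule S) :
  PC_cls (fgp_sum P Q) = (PC_cls P + PC_cls Q)%M.
Proof. by rewrite /PC_cls monP_clsD mquot_clsD. Qed.

Lemma PC_surj (c : PC S) : exists P, c = PC_cls P.
Proof.
have [m ->] := mquotP c; have [P ->] := quotP m.
by exists P.
Qed.

End FgpRetract.

(** * Units of $PC^{diff}(R)$ as differential retracts of $(R^n, 0)$ *)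

Section DiffMonoid.
Variable R : diffRingType.

Lemma PCdiff_clsP (M N : diffModule R) : PCdiff_cls M = PCdiff_cls N <->
  exists m n, diff_iso (dm_sum M (dm_free R m)) (dm_sum N (dm_free R n)).
Proof.
split=> [/mquot_clsP[_ [_ [[m ->] [n ->]]]]|[m [n iso]]].
  by rewrite -!monPdiff_clsD => /monPdiff_clsP; exists m, n.
apply/mquot_clsP; exists (monPdiff_cls (dm_free R m)), (monPdiff_cls (dm_free R n)).
by split; [exists m|exists n|rewrite -!monPdiff_clsD; apply/monPdiff_clsP].
Qed.

Lemma PCdiff_clsD (M N : diffModule R) :
  PCdiff_cls (dm_sum M N) = (PCdiff_cls M + PCdiff_cls N)%M.
Proof. by rewrite /PCdiff_cls monPdiff_clsD mquot_clsD. Qed.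

Lemma PCdiff_surj (c : PCdiff R) : exists M, c = PCdiff_cls M.
Proof.
have [m ->] := mquotP c; have [M ->] := quotP m.
by exists M.
Qed.

Lemma diff_iso_cls (M N : diffModule R) :
  diff_iso M N -> PCdiff_cls M = PCdiff_cls N.
Proof. by move=> MN; congr mquot_cls; apply/monPdiff_clsP. Qed.

Lemma PCdiff_cls_free n : PCdiff_cls (dm_free R n) = 0%M.
Proof.
(* The zero class is that of $R^0$, and $R^n ⊕ R^0 ≅ R^0 ⊕ R^n$. *)
apply/(PCdiff_clsP _ (dm_free R 0)); exists 0%N, n; exact: dm_sumC.
Qed.

Lemma dm_der0 (M : diffModule R) : dm_der (0 : M) = 0.
Proof. by apply: (addrI (dm_der 0)); rewrite -dm_derD !addr0. Qed.

(** If $[N]$ is opposite to $[M]$, then $(M ⊕ N) ⊕ R^a ≅ R^0 ⊕ R^b ≅ R^b$ differentially, so $M$ is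
    a differential direct summand of $(R^b, 0)$. *)
Lemma unit_diff_retract (M : diffModule R) :
  (exists y, (PCdiff_cls M + y = 0)%M) ->
  exists n (i : {linear M -> dm_free R n}) (p : {linear dm_free R n -> M}),
    [/\ cancel i p, forall x, i (dm_der x) = dm_der (i x)
      & forall x, p (dm_der x) = dm_der (p x)].
Proof.
move=> [y]; have [N ->] := PCdiff_surj y; rewrite -PCdiff_clsD.
rewrite -(PCdiff_cls_free 0) => /PCdiff_clsP[a [b]].
move=> iso; have := equiv_trans (@diff_iso_equiv R) iso (dm_sum0 (dm_free R b)).
move=> [f /linear_inverse[g fK gK] fD].
exists b, (f \o linear_of (@pairl_linear R (dm_sum M N) (dm_free R a)) \o
  linear_of (@pairl_linear R M N) : {linear _ -> _}).
exists ((fst : {linear (M * N)%type -> M}) \o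
  ((fst : {linear (dm_sum M N * dm_free R a)%type -> dm_sum M N}) \o g)
  : {linear _ -> _}).
have gD x : g (dm_der x) = dm_der (g x) by apply: (can_inj fK); rewrite fD !gK.
split=> x /=; first by rewrite fK.
  (* The injection $x ↦ ((x, 0), 0)$ is differential because $D(0) = 0$ in both complementary
     summands. *)
  by rewrite -[RHS]fD /=; congr (f (_, _, _)); apply: esym; apply: dm_der0.
by rewrite gD.
Qed.

End DiffMonoid.

(** * Base change as a functor, and recovery of $P$ as the constants of $R ⊗ P$ *)

Section BaseChangeMaps.
Variable R : diffRingType.
Notation S := (constants R).
Notation incl := (incl R).
Notation T := (@base_change_diff R).

Lemma base_change_der_tprod (P : fgpModule S) r (x : P) :
  dm_der (tprod incl r x : T P) = tprod incl (deriv r) x.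
Proof. exact: tlift_tprod (@deriv_S_linear R). Qed.

(** When $h(x)$ is constant, $D(r h(x)) = D(r) h(x)$, which is the image of $D(r) ⊗ x$. *)
Lemma text_diff (P : fgpModule S) (M : diffModule R)
    (h : {linear P -> restr incl M}) :
  (forall x, dm_der (h x : M) = 0) ->
  forall c : T P, text h (dm_der c) = dm_der (text h c : M).
Proof.
move=> hD; elim/tensor_ind => [|c d Ec Ed|r x].
- by rewrite !(dm_der0, linear0).
- by rewrite !(dm_derD, linearD) Ec Ed.
- rewrite base_change_der_tprod !linear_ofE !text_tprod dm_derZ hD.
  by rewrite scaler0 addr0.
Qed.

Lemma base_change_der_tprod1 (P : fgpModule S) (x : P) :
  dm_der (tprod incl 1 x : T P) = 0.
Proof. by rewrite base_change_der_tprod deriv1 tprodE scale0r. Qed.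

Lemma tensor_map_diff (P Q : fgpModule S) (f : {linear P -> Q}) (c : T P) :
  tensor_map incl f (dm_der c) = dm_der (tensor_map incl f c : T Q).
Proof. by apply: (@text_diff P (T Q)) => x; apply: base_change_der_tprod1. Qed.

Lemma text_free_diff n (c : T (fgp_free S n)) :
  text (map_mx_restr incl n) (dm_der c) =
  dm_der (text (map_mx_restr incl n) c : dm_free R n).
Proof.
apply: (@text_diff (fgp_free S n) (dm_free R n)) => v.
by apply/rowP => i; rewrite !mxE deriv_constant.
Qed.

Lemma base_change_congr (P Q : fgpModule S) :
  fgp_iso P Q -> diff_iso (T P) (T Q).
Proof.
move=> [f /linear_inverse[g fK gK]].
exists (tensor_map incl f); last exact: tensor_map_diff.
by exists (tensor_map incl g); apply: tensor_map_cancel.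
Qed.

Lemma base_change_free n : diff_iso (T (fgp_free S n)) (dm_free R n).
Proof.
exists (text (map_mx_restr incl n)); first exact: tensor_free_bij.
exact: text_free_diff.
Qed.

Lemma base_change_sum (P Q : fgpModule S) :
  diff_iso (T (fgp_sum P Q)) (dm_sum (T P) (T Q)).
Proof.
exists (tensor_pair incl P Q); first exact: tensor_pair_bij.
apply: (@text_diff _ (dm_sum (T P) (T Q))) => -[x y].
by congr pair; apply: base_change_der_tprod1.
Qed.

Lemma constant_vector n (w : dm_free R n) :
  dm_der w = 0 -> exists v : 'rV[S]_n, w = map_mx incl v.
Proof.
move=> dw; have wP j : (w : 'rV[R]_n) 0 j \in @constant_pred R.
  by apply/eqP; have := congr1 (fun u : 'rV[R]_n => u 0 j) dw; rewrite !mxE.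
by exists (\row_j Constant (wP j)); apply/rowP => j; rewrite !mxE.
Qed.

Lemma map_mx_incl_inj n : injective (map_mx incl : 'rV[S]_n -> 'rV[R]_n).
Proof.
move=> u v /rowP uv; apply/rowP => j; apply: val_inj.
by have := uv j; rewrite !mxE.
Qed.

(** The composite $P → R ⊗ P → R ⊗ S^n ≅ R^n$ is the section [i] followed by the entrywise inclusion
    $S^n ⊆ R^n$, and both are injective. *)
Lemma tprod1_inj (P : fgpModule S) : injective (tprod incl 1 : P -> T P).
Proof.
have [n [i [p iK]]] := fgp_free_retract P => x y xy.
apply: (can_inj iK); apply: map_mx_incl_inj.
have := congr1 (fun c => text (map_mx_restr incl n) (tensor_map incl i c)) xy.
by rewrite !tensor_map_tprod !text_tprod1.
Qed.

(** Together with [tprod1_inj] this identifies $P$ with $(R ⊗ P)^D$. It is inherited from the free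
    case, where the constants of $R^n$ are $S^n$. *)
Lemma base_change_constant (P : fgpModule S) (c : T P) :
  dm_der c = 0 -> exists x, c = tprod incl 1 x.
Proof.
move=> dc; have [n [i [p iK]]] := fgp_free_retract P.
have : dm_der (text (map_mx_restr incl n) (tensor_map incl i c) : dm_free R n) = 0.
  rewrite -(@text_free_diff n (tensor_map incl i c)).
  by rewrite -(@tensor_map_diff P (fgp_free S n)) dc !linear0.
(* The image of [c] in $R ⊗ S^n$ is $1 ⊗ v$; applying $\mathrm{id} ⊗ p$ returns [c] on one side and
   $1 ⊗ p(v)$ on the other. *)
move=> /constant_vector[v cv]; exists (p v).
rewrite -[LHS](tensor_map_cancel iK) -tensor_map_tprod; congr (tensor_map _ _ _).
by apply: (bij_inj (tensor_free_bij incl n)); rewrite cv text_tprod1.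
Qed.

(** A differential isomorphism and its inverse preserve constants, so they restrict to mutually
    inverse maps between $P$ and $Q$. *)
Lemma base_change_inj (P Q : fgpModule S) :
  diff_iso (T P) (T Q) -> fgp_iso P Q.
Proof.
move=> [f /linear_inverse[g fK gK] fD].
(* Every differential map between base changes comes from a linear map over the constants; linearity
   of [k] follows from injectivity of $y ↦ 1 ⊗ y$. *)
have cst (A B : fgpModule S) (h : {linear T A -> T B}) :
    (forall c, h (dm_der c) = dm_der (h c)) ->
    exists k : {linear A -> B}, forall x, h (tprod incl 1 x) = tprod incl 1 (k x).
  move=> hD; have ex x : exists y, h (tprod incl 1 x) = tprod incl 1 y.
    by apply: base_change_constant; rewrite -hD base_change_der_tprod1 linear0.
  have [k kP] := boolp.choice ex.
  have lin : linear k.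
    move=> a x y; apply: tprod1_inj.
    by rewrite -kP !tprodDr !tprod1Z linearP !kP.
  by exists (linear_of lin) => x; rewrite kP.
have gD c : g (dm_der c) = dm_der (g c) by apply: (can_inj fK); rewrite fD !gK.
have [[k kP] [l lP]] := (cst _ _ f fD, cst _ _ g gD).
exists k; exists l => x; apply: tprod1_inj; first by rewrite -lP -kP fK.
by rewrite -kP -lP gK.
Qed.

End BaseChangeMaps.

(** * The module of constants $M^D$ and descent of differential retracts *)

Section ConstantsModule.
Variables (R : diffRingType) (M : diffModule R).
Notation S := (constants R).
Notation incl := (incl R).

Lemma dm_der_linear : linear (@dm_der R M : restr incl M -> restr incl M).
Proof.
move=> a x y; rewrite dm_derD; congr (_ + _).
by rewrite [LHS]dm_derZ deriv_constant scale0r add0r.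
Qed.

(** This is $M^D$; $D_M$ is linear only after scalars are restricted to the constants, hence the
    kernel is taken there. *)
Definition dm_constants : lmodType S := kernel (linear_of dm_der_linear).

Definition dm_constants_val : {linear dm_constants -> restr incl M} :=
  (val : kernel (linear_of dm_der_linear) -> restr incl M).

Lemma dm_constants_val_inj : injective dm_constants_val.
Proof. exact: val_inj. Qed.

Lemma dm_constantsP (m : M) : dm_der m = 0 -> exists x, dm_constants_val x = m.
Proof.
move=> dm; have mP : m \in kernel_pred (linear_of dm_der_linear) by apply/eqP.
by exists (@Kernel _ (restr incl M) _ _ m mP).
Qed.

Lemma dm_der_constant (x : dm_constants) : dm_der (dm_constants_val x : M) = 0.
Proof. by apply/eqP; case: x. Qed.

Variables (n : nat) (i : {linear M -> dm_free R n}) (p : {linear dm_free R n -> M}).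
Hypotheses (iK : cancel i p) (iD : forall x, i (dm_der x) = dm_der (i x))
  (pD : forall x, p (dm_der x) = dm_der (p x)).

(** Differential maps carry constants to constants, so [i] and [p] restrict to maps between $M^D$
    and $(R^n)^D = S^n$, and the retraction identity restricts with them. *)
Lemma retract_constants :
  exists (j : {linear dm_constants -> 'rV[S]_n}) (q : {linear 'rV[S]_n -> dm_constants}),
  [/\ cancel j q, forall x, i (dm_constants_val x) = map_mx incl (j x)
    & forall v, dm_constants_val (q v) = p (map_mx incl v)].
Proof.
have ex (x : dm_constants) : exists v : 'rV[S]_n, i (dm_constants_val x) = map_mx incl v.
  by apply: constant_vector; rewrite -iD dm_der_constant linear0.
have [j jP] := boolp.choice ex; have linj : linear j.
  move=> a x y; apply: map_mx_incl_inj; rewrite -jP map_mxD map_mxZ -!jP.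
  exact: (linearP i).
have ex' (v : 'rV[S]_n) : exists x, dm_constants_val x = p (map_mx incl v).
  apply: dm_constantsP; rewrite -pD -[RHS](linear0 p); congr (p _).
  by apply/rowP => k; rewrite !mxE deriv_constant.
have [q qP] := boolp.choice ex'; have linp : linear q.
  move=> a u v; apply: dm_constants_val_inj.
  rewrite linearP !qP map_mxD map_mxZ.
  exact: (linearP p).
exists (linear_of linj), (linear_of linp); split=> // x.
by apply: dm_constants_val_inj; rewrite qP -jP iK.
Qed.

(** Take $P = M^D$, finitely generated projective as a retract of $S^n$, and the canonical map $r ⊗
    x ↦ r x$. *)
Lemma retract_base_change : exists P, diff_iso (base_change_diff P) M.
Proof.
have [j [q [jK jP qP]]] := retract_constants.
have qs y : exists x, q x = y by exists (j y).
pose P := FgpModule (fg_retract qs (fg_free S n)) (proj_retract jK (@proj_free S n)).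
exists P, (text dm_constants_val); last by apply: text_diff; apply: dm_der_constant.
(* Under $R^n ≅ R ⊗ S^n$ this is $\mathrm{id} ⊗ q$; composed with [i] it inverts the canonical
   map. *)
pose g := lincomb (fun k => tprod incl 1 (q (delta_mx 0 k))).
exists (g \o i : {linear _ -> _}).
  apply: tensor_cancel => x; rewrite text_tprod1 -[LHS]/(g (i _)) jP -[in RHS](jK x).
  rewrite [in RHS](row_sum_delta (j x)) linear_sum tprod1_sum.
  by apply: eq_bigr => k _; rewrite linearZ tprod1Z mxE.
(* Expand $m = p(i(m))$ along the basis of $R^n$; on each $e_k$ the maps [q] and [p] agree inside
   $M$. *)
move=> m; rewrite -[RHS]iK [in RHS](row_sum_delta (i m)) !linear_sum.
apply: eq_bigr => k _; rewrite !linearZ text_tprod1 qP; congr (_ *: p _).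
by apply/rowP => l; rewrite !mxE rmorph_nat.
Qed.

End ConstantsModule.

(** * The isomorphism on classes *)

Lemma base_change_trivial_sum (R : diffRingType) (P : fgpModule (constants R)) n :
  diff_iso (base_change_diff (fgp_sum P (fgp_free _ n)))
    (dm_sum (base_change_diff P) (dm_free R n)).
Proof.
have refl := equiv_refl (@diff_iso_equiv R) (base_change_diff P).
apply: (equiv_trans (@diff_iso_equiv R) (base_change_sum _ _)).
exact: dm_sum_congr refl (base_change_free R n).
Qed.

(** Left to right makes [q] well defined, right to left makes it injective. Base change turns $P ⊕
    S^m$ into $(R ⊗ P) ⊕ (R^m, 0)$, and [base_change_inj] descends stable isomorphisms. *)
Lemma PC_cls_base_change (R : diffRingType) (P Q : fgpModule (constants R)) :
  PC_cls P = PC_cls Q <->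
  PCdiff_cls (base_change_diff P) = PCdiff_cls (base_change_diff Q).
Proof.
have trans := equiv_trans (@diff_iso_equiv R).
have sym := equiv_sym (@diff_iso_equiv R).
split=> [/PC_clsP|/PCdiff_clsP] [m [n iso]].
  apply/PCdiff_clsP; exists m, n.
  apply: (trans _ _ _ (sym _ _ (base_change_trivial_sum P m))).
  exact: (trans _ _ _ (base_change_congr iso) (base_change_trivial_sum Q n)).
apply/PC_clsP; exists m, n; apply: base_change_inj.
apply: (trans _ _ _ (base_change_trivial_sum P m)).
exact: (trans _ _ _ iso (sym _ _ (base_change_trivial_sum Q n))).
Qed.

Lemma PCdiff_cls_base_changeD (R : diffRingType) (P Q : fgpModule (constants R)) :
  PCdiff_cls (base_change_diff (fgp_sum P Q)) =
  (PCdiff_cls (base_change_diff P) + PCdiff_cls (base_change_diff Q))%M.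
Proof. by rewrite -PCdiff_clsD; apply: diff_iso_cls; apply: base_change_sum. Qed.

(** If $P ⊕ N ≅ S^n$, then $R ⊗ N$ represents the opposite, since $R ⊗ S^n ≅ (R^n, 0)$ has class
    zero. *)
Lemma base_change_unit (R : diffRingType) (P : fgpModule (constants R)) :
  exists y, (PCdiff_cls (base_change_diff P) + y = 0)%M.
Proof.
have [N [n iso]] := fgp_complement P.
exists (PCdiff_cls (base_change_diff N)); rewrite -PCdiff_cls_base_changeD.
rewrite -(PCdiff_cls_free R n); apply: diff_iso_cls.
by apply: (equiv_trans (@diff_iso_equiv R) (base_change_congr iso)); apply: base_change_free.
Qed.

Theorem proposition3 (R : diffRingType) :
  exists q : PC (constants R) -> unit_group (PCdiff R),
    group_isomorphism q /\
    forall P0 : fgpModule (constants R),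
      unit_val (q (PC_cls P0)) = PCdiff_cls (base_change_diff P0).
Proof.
(* [q] is defined on chosen representatives; [qE] then shows that its value does not depend on the
   choice. *)
have [rep repP] := boolp.choice (@PC_surj (constants R)).
pose q c : unit_group (PCdiff R) := UnitElt (base_change_unit (rep c)).
have qE P : unit_val (q (PC_cls P)) = PCdiff_cls (base_change_diff P).
  by apply/PC_cls_base_change; rewrite -repP.
have q_inj : injective q.
  move=> x y; have [[P ->] [Q ->]] := (PC_surj x, PC_surj y).
  by move=> /(congr1 (@unit_val _)); rewrite !qE => /PC_cls_base_change.
(* A unit is the class of a differential retract $M$ of some $(R^n, 0)$, and such an $M$ is the base
   change of $M^D$. *)
have q_surj u : exists x, q x = u.
  have [M uM] := PCdiff_surj (unit_val u).
  have := unit_valP u; rewrite uM.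
  move=> /unit_diff_retract[n [i [p [iK iD pD]]]].
  have [P PM] := retract_base_change iK iD pD.
  by exists (PC_cls P); apply: unit_val_inj; rewrite qE uM; apply: diff_iso_cls.
exists q; split=> //; split=> [x y|].
  have [[P ->] [Q ->]] := (PC_surj x, PC_surj y).
  by apply: unit_val_inj; rewrite -PC_clsD qE PCdiff_cls_base_changeD -!qE.
have [r rK] := boolp.choice q_surj.
by exists r => // x; apply: q_inj.
Qed.
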